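(* A 4-tuple of numbers $(t;p_1,p_2,p_3)$ (with the $p_i$ unordered) is the symbol of some three-card hand of the 81-card SET deck if and only if all of the following hold: \begin{align*} t&\in\{0,1,2,3\},\\ p_i&\in\{0,1,2,3\}\quad\text{for each } i\in\{1,2,3\},\\ p_i+t&\in\{0,1,2,3\}\quad\text{for each } i\in\{1,2,3\},\\ t+p_1+p_2+p_3&\in\{0,1,2,3,4\}. \end{align*}
   Context: **Deck.** Let $A=\{\text{color},\text{shape},\text{fill},\text{number}\}$ be the set of four attributes. For each $a\in A$ let $V_a$ be the set of three values of attribute $a$: $V_{\text{color}}=\{\text{red, green, purple}\}$, $V_{\text{shape}}=\{\text{oval, diamond, squiggle}\}$, $V_{\text{fill}}=\{\text{solid, empty, stripe}\}$, $V_{\text{number}}=\{\text{single, double, triple}\}$. The SET deck consists of $3^4=81$ cards, exactly one for each choice of a value in each attribute (that is, the deck is identified with $\prod_{a\in A}V_a$). For a card $x$ and $a\in A$, $v_a(x)\in V_a$ denotes the value of $x$ for attribute $a$. A hand is a subset of the deck; a three-card hand is a subset with exactly three elements. **Symbol.** Let $H=\{x_1,x_2,x_3\}$ be a hand with exactly three cards. Its symbol is $(t;p_1,p_2,p_3)$, where the $p_i$'s are unordered (i.e. $\{p_1,p_2,p_3\}$ is regarded as a multiset). Here $t$ is the number of attributes $a\in A$ on which all three cards have the same value, and the $p_i$'s are, for each of the three pairs of cards of $H$, the number of attributes on which the two cards of that pair have the same value but which are not among the $t$ attributes common to all three cards. *)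

(* Defs.v *)
From HB Require Import structures.
From mathcomp Require Import all_boot finmap multiset.

Set Implicit Arguments.
Unset Strict Implicit.
Unset Printing Implicit Defensive.

Variant attribute := Color | Shape | Fill | Number.
Variant color_value := Red | Green | Purple.
Variant shape_value := Oval | Diamond | Squiggle.
Variant fill_value := Solid | Empty | Stripe.
Variant number_value := Single | Double | Triple.

(* The finite type structures are transported from bool * bool and
   option bool along the following codings. *)

Definition attribute_code (a : attribute) : bool * bool :=
  match a with
  | Color => (true, true) | Shape => (true, false)
  | Fill => (false, true) | Number => (false, false)
  end.
Definition attribute_decode (c : bool * bool) : attribute :=
  match c with
  | (true, true) => Color | (true, false) => Shape
  | (false, true) => Fill | (false, false) => Number
  end.
Lemma attribute_codeK : cancel attribute_code attribute_decode.
Proof. by case. Qed.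
HB.instance Definition _ := Countable.copy attribute (can_type attribute_codeK).
HB.instance Definition _ : isFinite attribute := CanIsFinite attribute_codeK.

Definition color_code (v : color_value) : option bool :=
  match v with Red => None | Green => Some false | Purple => Some true end.
Definition color_decode (c : option bool) : color_value :=
  match c with None => Red | Some false => Green | Some true => Purple end.
Lemma color_codeK : cancel color_code color_decode.
Proof. by case. Qed.
HB.instance Definition _ := Countable.copy color_value (can_type color_codeK).
HB.instance Definition _ : isFinite color_value := CanIsFinite color_codeK.

Definition shape_code (v : shape_value) : option bool :=
  match v with Oval => None | Diamond => Some false | Squiggle => Some true end.
Definition shape_decode (c : option bool) : shape_value :=
  match c with None => Oval | Some false => Diamond | Some true => Squiggle end.
Lemma shape_codeK : cancel shape_code shape_decode.
Proof. by case. Qed.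
HB.instance Definition _ := Countable.copy shape_value (can_type shape_codeK).
HB.instance Definition _ : isFinite shape_value := CanIsFinite shape_codeK.

Definition fill_code (v : fill_value) : option bool :=
  match v with Solid => None | Empty => Some false | Stripe => Some true end.
Definition fill_decode (c : option bool) : fill_value :=
  match c with None => Solid | Some false => Empty | Some true => Stripe end.
Lemma fill_codeK : cancel fill_code fill_decode.
Proof. by case. Qed.
HB.instance Definition _ := Countable.copy fill_value (can_type fill_codeK).
HB.instance Definition _ : isFinite fill_value := CanIsFinite fill_codeK.

Definition number_code (v : number_value) : option bool :=
  match v with Single => None | Double => Some false | Triple => Some true end.
Definition number_decode (c : option bool) : number_value :=
  match c with None => Single | Some false => Double | Some true => Triple end.
Lemma number_codeK : cancel number_code number_decode.
Proof. by case. Qed.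
HB.instance Definition _ := Countable.copy number_value (can_type number_codeK).
HB.instance Definition _ : isFinite number_value := CanIsFinite number_codeK.

Definition value (a : attribute) : finType :=
  match a with
  | Color => color_value
  | Shape => shape_value
  | Fill => fill_value
  | Number => number_value
  end.

(* The deck is the product of the four value sets; for x : deck, x a is the
   value of x for the attribute a. *)
Definition deck : finType := {dffun forall a : attribute, value a}.

Definition common (S : {set deck}) : {set attribute} :=
  [set a | [forall x in S, forall y in S, x a == y a]].

Definition pairs (H : {set deck}) : {set {set deck}} :=
  [set P : {set deck} | P \subset H & #|P| == 2].

(* The p_i are collected as a multiset indexed by the pairs contained in H, so
   no ordering of the cards of H is chosen. *)
Definition symbol (H : {set deck}) : nat * {mset nat}%mset :=
  (#|common H|,
   seq_mset [seq #|common P :\: common H| | P : {set deck} <- enum (pairs H)]).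

(* Main.v *)
(** The attributes on which exactly one given pair of cards agrees form three
    disjoint sets, also disjoint from the set of common attributes; this bounds
    the sum by 4, while [t + p_i = 4] would make two cards equal. Conversely,
    distribute the four attributes into classes of sizes [t], [p1], [p2], [p3]
    and a rest, and choose the values of the three cards class by class. *)
Require Import Defs.
From mathcomp Require Import all_boot finmap multiset zify.

Set Implicit Arguments.
Unset Strict Implicit.
Unset Printing Implicit Defensive.

Lemma cards3_ex (T : finType) (A : {set T}) : #|A| = 3 ->
  exists x y z, [/\ x != y, x != z, y != z & A = [set x; y; z]].
Proof.
move=> A3; have /card_gt0P[z zA] : 0 < #|A| by rewrite A3.
have /cards2P[x [y [xy Axy]]] : #|A :\ z| == 2.
  by have := cardsD1 z A; rewrite zA A3 add1n => -[<-].
have zNxy : z \notin [set x; y] by rewrite -Axy !inE eqxx.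
exists x, y, z; move: zNxy; rewrite !inE negb_or !(eq_sym z) => /andP[-> ->].
by split=> //; rewrite -(setD1K zA) Axy setUC.
Qed.

(** This makes the indexing by pairs in [symbol] explicit. A permutation is the right relation,
    since the order of [enum] is unspecified and [seq_mset] forgets it anyway. *)
Lemma perm_subsets2 (T : finType) (x y z : T) :
  x != y -> x != z -> y != z ->
  perm_eq (enum [set P : {set T} | P \subset [set x; y; z] & #|P| == 2])
    [:: [set x; y]; [set x; z]; [set y; z]].
Proof.
move=> xy xz yz; apply: uniq_perm; first exact: enum_uniq.
  rewrite /= !inE !negb_or !andbT -andbA; apply/and3P; split; apply/eqP => /setP E.
  - by move: (E y); rewrite !inE eqxx orbT eq_sym (negPf xy) (negPf yz).
  - by move: (E x); rewrite !inE eqxx (negPf xy) (negPf xz).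
  - by move: (E x); rewrite !inE eqxx (negPf xy) (negPf xz).
move=> P; rewrite mem_enum !inE; apply/andP/or3P.
  case=> /subsetP PH /cards2P[u [v [uv eP]]].
  have := PH u; have := PH v; rewrite eP !inE !eqxx orbT /=.
  (* Of the nine choices for [(u, v)], the three diagonal ones contradict [uv]; the other six give
     each pair in both orders. *)
  move=> /(_ isT) /orP[/orP[]|] /eqP ev /(_ isT) /orP[/orP[]|] /eqP eu;
    move: uv; rewrite ev eu ?eqxx // => _.
  - by constructor 1; rewrite setUC.
  - by constructor 2; rewrite setUC.
  - by constructor 1.
  - by constructor 3; rewrite setUC.
  - by constructor 2.
  - by constructor 3.
by case=> /eqP ->; rewrite cards2 ?xy ?xz ?yz; split=> //;
  apply/subsetP=> u; rewrite !inE => /orP[] ->; rewrite ?orbT.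
Qed.

Lemma in_common2 (x y : deck) a : (a \in common [set x; y]) = (x a == y a).
Proof.
rewrite inE; apply/'forall_implyP/eqP => [/(_ x)|E u].
  by rewrite !inE eqxx => /(_ isT) /'forall_implyP /(_ y);
    rewrite !inE eqxx orbT => /(_ isT) /eqP.
by rewrite !inE => /orP[] /eqP ->; apply/'forall_implyP => v;
  rewrite !inE => /orP[] /eqP ->; rewrite ?E.
Qed.

Lemma in_common3 (x y z : deck) a :
  (a \in common [set x; y; z]) = (x a == y a) && (x a == z a).
Proof.
rewrite inE; apply/'forall_implyP/andP => [/(_ x)|[/eqP E1 /eqP E2] u].
  rewrite !inE eqxx => /(_ isT) /'forall_implyP E.
  by split; [have := E y | have := E z]; rewrite !inE eqxx !orbT => /(_ isT).
by rewrite !inE => /orP[/orP[]|] /eqP ->; apply/'forall_implyP => v;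
  rewrite !inE => /orP[/orP[]|] /eqP ->; rewrite -?E1 -?E2.
Qed.

Lemma symbol_cards (x y z : deck) : x != y -> x != z -> y != z ->
  let C := common [set x; y; z] in
  symbol [set x; y; z] =
    (#|C|, seq_mset [:: #|common [set x; y] :\: C|; #|common [set x; z] :\: C|;
                        #|common [set y; z] :\: C|]).
Proof.
move=> xy xz yz C; rewrite /symbol; congr pair; apply/eq_seq_msetP.
exact: (perm_map (fun P => #|common P :\: C|) (perm_subsets2 xy xz yz)).
Qed.

Lemma card_attribute : #|{: attribute}| = 4.
Proof.
have e : enum {: attribute} =i [:: Color; Shape; Fill; Number].
  by move=> a; rewrite mem_enum; case: a.
by rewrite cardE (perm_size (uniq_perm (enum_uniq _) _ e)).
Qed.

(** Cards are functions on the four attributes, so agreeing everywhere forces equality by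
    extensionality. *)
Lemma card_common2_lt (x y : deck) : x != y -> #|common [set x; y]| < 4.
Proof.
move=> xy; rewrite -card_attribute -cardsT proper_card // properT.
apply: contra_neq xy => /setP E; apply/ffunP => a.
by apply/eqP; rewrite -in_common2 E inE.
Qed.

(** Reading the word along the enumeration of [T] labels its elements; this yields a partition with
    prescribed class sizes. The default of [nth] is never reached, since ranks stay below
    [size s]. *)
Lemma card_preim_word (T : finType) (s : seq nat) : size s = #|T| ->
  exists c : T -> nat, forall P : pred nat, #|[set a | P (c a)]| = count P s.
Proof.
move=> ss; exists (fun a => nth 0 s (enum_rank a)) => P.
rewrite cardsE cardE size_filter -enumT.
have -> : count [in P \o (fun a => nth 0 s (enum_rank a))] (enum T) =
   count P [seq nth 0 s (enum_rank a) | a <- enum T] by rewrite count_map.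
congr count; apply: (@eq_from_nth _ 0); rewrite size_map -cardE //.
move=> i iT; have /card_gt0P[x0 _] := leq_ltn_trans (leq0n i) iT.
rewrite (nth_map x0) -?cardE //; congr nth.
by rewrite -[i]/(val (Ordinal iT)) -enum_val_nth enum_valK.
Qed.

(** A uniform numbering of the values lets a card be defined on all attributes at once. Indices from
    3 on fall back to the first value, so injectivity holds only below 3. *)
Definition nth_value (a : attribute) (i : nat) : value a :=
  match a with
  | Color => nth Red [:: Red; Green; Purple] i
  | Shape => nth Oval [:: Oval; Diamond; Squiggle] i
  | Fill => nth Solid [:: Solid; Empty; Stripe] i
  | Number => nth Single [:: Single; Double; Triple] i
  end.

Lemma eq_nth_value a i j : i < 3 -> j < 3 ->
  (nth_value a i == nth_value a j) = (i == j).
Proof. by case: a; case: i => [|[|[|]]] //; case: j => [|[|[|]]]. Qed.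

Theorem theorem2 (t p1 p2 p3 : nat) :
  (exists H : {set deck},
      #|H| = 3 /\ symbol H = (t, seq_mset [:: p1; p2; p3])) <->
  [/\ t \in [:: 0; 1; 2; 3],
      forall p, p \in [:: p1; p2; p3] -> p \in [:: 0; 1; 2; 3],
      forall p, p \in [:: p1; p2; p3] -> p + t \in [:: 0; 1; 2; 3]
    & t + p1 + p2 + p3 \in [:: 0; 1; 2; 3; 4]].
Proof.
have lt4 n : (n \in [:: 0; 1; 2; 3]) = (n < 4) by rewrite !inE; lia.
have lt5 n : (n \in [:: 0; 1; 2; 3; 4]) = (n < 5) by rewrite !inE; lia.
rewrite lt4 lt5; split.
  case=> H [/cards3_ex[x [y [z [xy xz yz ->]]]]].
  rewrite symbol_cards //; set C := common _; case=> tC /eq_seq_msetP pD.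
  have subC u v : u \in [set x; y; z] -> v \in [set x; y; z] ->
      C \subset common [set u; v].
    move=> uH vH; apply/subsetP => a; rewrite in_common2 in_common3.
    move=> /andP[/eqP E1 /eqP E2]; move: uH vH; rewrite !inE.
    by do 2![move=> /orP[/orP[]|] /eqP ->]; rewrite -?E1 -?E2.
  (* As [C] lies inside the agreement set of each pair, that set has exactly [t] elements more than
     its part outside [C]. *)
  have bnd u v : u != v -> u \in [set x; y; z] -> v \in [set x; y; z] ->
      #|common [set u; v] :\: C| + t < 4.
    move=> uv uH vH; have := card_common2_lt uv.
    by rewrite -(cardsID C) (setIidPr (subC _ _ uH vH)) tC addnC.
  have bp p : p \in [:: p1; p2; p3] -> p + t < 4.
    rewrite -(perm_mem pD) !inE => /or3P[] /eqP ->;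
      by apply: bnd; rewrite // !inE eqxx ?orbT.
  split=> [|p /bp|p /bp|]; rewrite ?lt4 //; last first.
  (* The [p_i] match the three pairs only up to order, so the bound goes through their sum, which is
     permutation invariant. *)
  - have -> : t + p1 + p2 + p3 = t + sumn [:: p1; p2; p3] by rewrite /=; lia.
    rewrite -(perm_sumn pD) -tC /= addn0 ltnS -card_attribute.
    have dU (A B : {set attribute}) : [disjoint A & B] ->
        #|A| + #|B| = #|A :|: B|.
      by rewrite -(leq_card_setU A B).2 => /eqP ->.
    (* By transitivity, an attribute on which two of the pairs agree lies in [C]; this gives the
       disjointness of the four sets. *)
    have tr1 a : (x a == z a) && (y a == z a) ==> (x a == y a).
      by apply/implyP => /andP[/eqP -> /eqP ->].
    have tr2 a : (x a == y a) && (y a == z a) ==> (x a == z a).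
      by apply/implyP => /andP[/eqP -> /eqP ->].
    by rewrite !dU ?max_card // -setI_eq0; apply/eqP/setP => a;
      rewrite !(in_setU, in_setI, in_setD, in_set0, in_common2, in_common3);
      have := tr1 a; have := tr2 a;
      case: (x a == y a); case: (x a == z a); case: (y a == z a) => //.
  - lia.
  - by have := bp p1; rewrite mem_head => /(_ isT); lia.
case=> t4 _ pt4 sum5.
have {}pt4 p : p \in [:: p1; p2; p3] -> p + t < 4 by move=> /pt4; rewrite lt4.
(* The label 4 fills up the word to length 4; [sum5] keeps the subtraction from truncating. *)
pose s := nseq t 0 ++ nseq p1 1 ++ nseq p2 2 ++ nseq p3 3
            ++ nseq (4 - (t + p1 + p2 + p3)) 4.
have [|c cP] := @card_preim_word attribute s.
  by rewrite card_attribute !size_cat !size_nseq; lia.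
have c5 a : c a < 5.
  have := cP (fun i => 4 < i); rewrite !count_cat !count_nseq /= !mul0n.
  by move=> /eqP; rewrite cards_eq0 => /eqP/setP /(_ a); rewrite !inE; lia.
(* Classes: 0, all cards agree; 1, only x and y; 2, only x and z; 3, only y and
   z; 4, no two cards agree. *)
pose x : deck := [ffun a => nth_value a 0].
pose y : deck := [ffun a => nth_value a (nth 0 [:: 0; 0; 1; 1; 1] (c a))].
pose z : deck := [ffun a => nth_value a (nth 0 [:: 0; 1; 0; 1; 2] (c a))].
have xyE a : (x a == y a) = (c a \in [:: 0; 1]).
  by rewrite !ffunE; case: (c a) (c5 a) => [|[|[|[|[|]]]]] // _;
    rewrite eq_nth_value.
have xzE a : (x a == z a) = (c a \in [:: 0; 2]).
  by rewrite !ffunE; case: (c a) (c5 a) => [|[|[|[|[|]]]]] // _;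
    rewrite eq_nth_value.
have yzE a : (y a == z a) = (c a \in [:: 0; 3]).
  by rewrite !ffunE; case: (c a) (c5 a) => [|[|[|[|[|]]]]] // _;
    rewrite eq_nth_value.
have card_c (P : pred nat) (A : {set attribute}) :
    (forall a, (a \in A) = P (c a)) -> #|A| = count P s.
  by move=> AP; rewrite -cP; apply: eq_card => a; rewrite inE AP.
(* If [u = v], every attribute has label 0 or [i], so [p + t = 4], against [pt4]. *)
have neq (u v : deck) i p : (forall a, (u a == v a) = (c a \in [:: 0; i])) ->
    count [in [:: 0; i]] s = p + t -> p \in [:: p1; p2; p3] -> u != v.
  move=> uvE cs /pt4; rewrite -cs; apply: contraTneq => uv.
  rewrite -(card_c _ setT) ?cardsT ?card_attribute // => a.
  by rewrite -uvE uv eqxx inE.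
have xy : x != y.
  apply: (neq _ _ _ p1 xyE); rewrite ?mem_head //.
  by rewrite !count_cat !count_nseq /=; lia.
have xz : x != z.
  apply: (neq _ _ _ p2 xzE); rewrite ?inE ?eqxx ?orbT //.
  by rewrite !count_cat !count_nseq /=; lia.
have yz : y != z.
  apply: (neq _ _ _ p3 yzE); rewrite ?inE ?eqxx ?orbT //.
  by rewrite !count_cat !count_nseq /=; lia.
exists [set x; y; z]; split.
  by rewrite setUC cardsU1 cards2 xy !inE negb_or !(eq_sym z) xz yz.
(* The four sets in the symbol are exactly the classes labelled 0 to 3, so their sizes are read off
   from the blocks of [s]. *)
rewrite symbol_cards // (card_c (pred1 0)) => [|a]; last first.
  by rewrite in_common3 xyE xzE !inE; lia.
rewrite (card_c (pred1 1)) => [|a]; last first.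
  by rewrite in_setD in_common2 in_common3 xyE xzE !inE; lia.
rewrite (card_c (pred1 2)) => [|a]; last first.
  by rewrite in_setD in_common2 in_common3 xyE xzE !inE; lia.
rewrite (card_c (pred1 3)) => [|a]; last first.
  by rewrite in_setD in_common2 in_common3 xyE xzE yzE !inE; lia.
rewrite !count_cat !count_nseq /=.
by rewrite !mul0n !mul1n !addn0.
Qed.
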